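(* Let $R$ be a polynomial ring in finitely many variables over a field and let $I \subseteq R$ be a proper ideal. If $f_1, \ldots, f_q$ form an initially regular sequence on $R/I$ with respect to a sequence of term orders $>_1, \ldots, >_q$, then $\mathrm{depth}\, R/I \geq q$.
   Context: $\mathfrak m$ is the ideal of $R$ generated by all the variables. A term order is a monomial order (a total order on monomials, compatible with multiplication, with $1$ smallest), and $\mathrm{in}_>(J)$ is the initial ideal of $J$ with respect to $>$. An element $f\in\mathfrak m$ is regular on $R/J$ if it is a non-zerodivisor on $R/J$. For a proper ideal $I$ and term orders $>_1,\dots,>_q$, a sequence of nonconstant polynomials $f_1,\dots,f_q\in\mathfrak m$ is an initially regular sequence on $R/I$ (with respect to $>_1,\dots,>_q$) if for each $i=1,\dots,q$, $f_i$ is a regular element on $R/I_i$, where $I_1=\mathrm{in}_{>_1}(I)$ and $I_i=\mathrm{in}_{>_i}\big((I_{i-1},f_{i-1})\big)$ for $i\ge 2$. Depth is taken with respect to $\mathfrak m$: $\mathrm{depth}\,R/I=\min\{d \mid \mathrm{Ext}^d_R(R/\mathfrak m,R/I)\neq 0\}$ ($+\infty$ if all these vanish). *)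

(* Defs.v *)
From HB Require Import structures.
From mathcomp Require Import all_boot all_order all_algebra.
From mathcomp Require Import boolp classical_sets.
From mathcomp Require Import generic_quotient ring_quotient freeg mpoly.

Set Implicit Arguments.
Unset Strict Implicit.
Unset Printing Implicit Defensive.

Import GRing.Theory.
Local Open Scope ring_scope.
Local Open Scope classical_set_scope.
Local Open Scope quotient_scope.

Section ModuleQuotient.
Variables (R : nzRingType) (V : lmodType R) (S : submodClosed V).

(* The library derives closure under opposite only for a constant head
   predicate, not for a variable S. *)
Definition submod_carrier : {pred V} := S.

Lemma submod_carrier_zmod : zmod_closed submod_carrier.
Proof.
split=> [|x y xS yS]; first exact: rpred0.
by rewrite -scaleN1r; apply: rpredD => //; apply: rpredZ.
Qed.

HB.instance Definition _ :=
  GRing.isZmodClosed.Build V submod_carrier submod_carrier_zmod.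

Definition lquot : Type := Quotient.quot submod_carrier.
HB.instance Definition _ := GRing.Zmodule.on lquot.
HB.instance Definition _ := EqQuotient.on lquot.
HB.instance Definition _ := ZmodQuotient.on lquot.

Definition lquot_scale (a : R) (x : lquot) : lquot := \pi_lquot (a *: repr x).

Lemma lquot_eqP (x y : V) : reflect (\pi_lquot x = \pi_lquot y) (x - y \in S).
Proof.
have -> : (x - y \in S) = (x == y %[mod lquot]).
  exact: (Quotient.idealrBE submod_carrier).
exact: eqP.
Qed.

Lemma pi_lquot_scale (a : R) (v : V) :
  lquot_scale a (\pi_lquot v) = \pi_lquot (a *: v).
Proof.
apply/lquot_eqP; rewrite -scalerBr; apply: rpredZ.
by apply/lquot_eqP; rewrite reprK.
Qed.

Lemma lquot_scaleA a b x :
  lquot_scale a (lquot_scale b x) = lquot_scale (a * b) x.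
Proof.
by elim/quotW: x => x; rewrite (pi_lquot_scale b) !pi_lquot_scale scalerA.
Qed.

Lemma lquot_scale1 : left_id 1 lquot_scale.
Proof. by elim/quotW=> x; rewrite pi_lquot_scale scale1r. Qed.
Lemma lquot_scaleDr : right_distributive lquot_scale +%R.
Proof.
move=> a; elim/quotW=> x; elim/quotW=> y.
by rewrite -(raddfD \pi_lquot) !pi_lquot_scale scalerDr raddfD.
Qed.
Lemma lquot_scaleDl v : {morph lquot_scale^~ v : a b / a + b}.
Proof.
by elim/quotW: v => v a b; rewrite !pi_lquot_scale scalerDl raddfD.
Qed.

HB.instance Definition _ := GRing.Zmodule_isLmodule.Build R lquot
  lquot_scaleA lquot_scale1 lquot_scaleDr lquot_scaleDl.

Lemma pi_lquot_is_scalable : scalable (\pi_lquot : V -> lquot).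
Proof. by move=> a v; rewrite -pi_lquot_scale. Qed.

End ModuleQuotient.

Section SpanSubmodule.
Variables (R : nzRingType) (V : lmodType R).

Definition submod_span (A : set V) : {pred V} := fun v =>
  `[< forall S : submodClosed V, (forall a, A a -> a \in S) -> v \in S >].

Lemma submod_span_closed (A : set V) : subsemimod_closed (submod_span A).
Proof.
split; [split|].
- by apply/asboolP => S _; apply: rpred0.
- move=> x y /asboolP xS /asboolP yS; apply/asboolP => S AS.
  by apply: rpredD; [apply: xS | apply: yS].
- by move=> a x /asboolP xS; apply/asboolP => S AS; apply/rpredZ/xS.
Qed.

HB.instance Definition _ (A : set V) :=
  GRing.isSubSemiModClosed.Build R V (submod_span A) (submod_span_closed A).

End SpanSubmodule.

(* Ideals of a commutative ring are its submodules as a module over itself.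
   Membership is boolean, which is no restriction in the presence of asbool. *)
Notation ideal R := (submodClosed (R^o)).

Section Ideals.
Variable R : comNzRingType.

Definition ideal_gen (A : set R) : ideal R := @submod_span R R^o A.

Definition ideal_adjoin (J : ideal R) (f : R) : ideal R :=
  ideal_gen ([set g : R | g \in J] `|` [set f]).

Definition is_proper (J : ideal R) : Prop := 1 \notin J.

Definition regular_on (f : R) (M : lmodType R) : Prop :=
  forall x : M, f *: x = 0 -> x = 0.

End Ideals.

Section Ext.
Variable R : nzRingType.

Definition projective (P : lmodType R) : Prop :=
  forall (A B : lmodType R) (g : {linear A -> B}) (f : {linear P -> B}),
    (forall b, exists a, g a = b) ->
    exists h : {linear P -> A}, forall x, g (h x) = f x.

Record proj_resolution (N : lmodType R) := ProjResolution {
  res_obj :> nat -> lmodType R;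
  res_diff : forall i, {linear res_obj i.+1 -> res_obj i};
  res_aug : {linear res_obj 0 -> N};
  res_projective : forall i, projective (res_obj i);
  res_aug_surj : forall z, exists x, res_aug x = z;
  res_exact0 : forall x, res_aug x = 0 <-> exists y, res_diff 0 y = x;
  res_exactS : forall i x,
    res_diff i x = 0 <-> exists y, res_diff i.+1 y = x
}.

Section Cohomology.
Variables (N M : lmodType R) (P : proj_resolution N).

Definition cocycle d (phi : {linear P d -> M}) : Prop :=
  forall y : P d.+1, phi (res_diff P d y) = 0.

Definition coboundary d : {linear P d -> M} -> Prop :=
  match d with
  | 0 => fun phi => forall x, phi x = 0
  | d'.+1 => fun phi =>
      exists psi : {linear P d' -> M}, forall x, phi x = psi (res_diff P d' x)
  end.

End Cohomology.

(* Ext^d_R(N, M) <> 0, i.e. H^d(Hom(P, M)) <> 0 for a projective resolution P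
   of N. By the comparison theorem the choice of P is immaterial; that one
   exists is proj_resolution_exists below. *)
Definition Ext_neq0 (d : nat) (N M : lmodType R) : Prop :=
  exists (P : proj_resolution N) (phi : {linear P d -> M}),
    cocycle phi /\ ~ coboundary phi.

End Ext.

Section LinearKernel.
Variables (R : nzRingType) (A B : lmodType R) (f : {linear A -> B}).

Definition lker_pred : {pred A} := [pred x | f x == 0].

Lemma lker_pred_closed : subsemimod_closed lker_pred.
Proof.
split; [split|]; rewrite ?inE ?raddf0//.
- move=> x y; rewrite !unfold_in /= => /eqP fx /eqP fy.
  by rewrite linearD /= fx fy addr0.
- by move=> a x; rewrite !unfold_in /= => /eqP fx; rewrite linearZ_LR fx scaler0.
Qed.

HB.instance Definition _ :=
  GRing.isSubmodClosed.Build R A lker_pred lker_pred_closed.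

Record lker_type := LkerType { lker_val :> A; _ : lker_val \in lker_pred }.
HB.instance Definition _ := [isSub for lker_val].
HB.instance Definition _ := [Choice of lker_type by <:].
HB.instance Definition _ := [SubChoice_isSubLmodule of lker_type by <:].

End LinearKernel.

Section ResolutionExists.
Variable R : nzRingType.

Section FreeLift.
Variables (K : choiceType) (A : lmodType R) (f : K -> A).

Lemma fglift_is_semilinear : semilinear (fglift f : {freeg K / R} -> A).
Proof.
have fB : zmod_morphism (fglift f : {freeg K / R} -> A) by exact: lift_is_additive.
pose fA : {additive {freeg K / R} -> A} :=
  HB.pack (fglift f) (GRing.isZmodMorphism.Build _ _ (fglift f) fB).
have fAE D : fglift f D = fA D by [].
have ZU (c k : R) (x : K) : c *: << k *g x >> = << c * k *g x >>.
  by apply/eqP/freeg_eqP => y; rewrite coeffZ !coeffU mulrA.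
split=> [c D | D E]; last by rewrite fAE raddfD.
rewrite -{1}(freeg_sumE D) scaler_sumr !fAE raddf_sum -(freeg_sumE D).
rewrite [in RHS]raddf_sum scaler_sumr freeg_sumE.
by apply: eq_bigr => x _; rewrite ZU -!fAE !liftU scalerA.
Qed.

HB.instance Definition _ := GRing.isSemilinear.Build R {freeg K / R} A _
  (fglift f) fglift_is_semilinear.

End FreeLift.

Lemma free_projective (K : choiceType) :
  projective ({freeg K / R} : lmodType R).
Proof.
move=> A B g f g_surj.
have [h hP] := choice (fun x : K => g_surj (f << x >>)).
exists (fglift h : {linear {freeg K / R} -> A}) => D.
rewrite -(freeg_sumE D) !raddf_sum /=; apply: eq_bigr => x _.
have -> : << coeff x D *g x >> = coeff x D *: << x >> :> {freeg K / R}.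
  by apply/eqP/freeg_eqP => y; rewrite coeffZ !coeffU mul1r.
by rewrite !linearZ /= liftU scale1r hP.
Qed.

Record res_stage := ResStage {
  stage_src : choiceType; stage_tgt : lmodType R;
  stage_map : {linear {freeg stage_src / R} -> stage_tgt} }.

Definition next_stage (s : res_stage) : res_stage :=
  @ResStage (lker_type (stage_map s)) {freeg (stage_src s) / R}
    (fglift (@lker_val _ _ _ (stage_map s))).

Lemma next_stage_exact s x :
  stage_map s x = 0 <-> exists y, stage_map (next_stage s) y = x.
Proof.
split=> [fx0 | [y <-]].
  have xK : x \in lker_pred (stage_map s) by rewrite inE fx0.
  by exists << LkerType xK >>; rewrite /= liftU scale1r.
rewrite -(freeg_sumE y) !raddf_sum big1// => z _.
transitivity (stage_map s (coeff z y *: lker_val z)).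
  by congr (stage_map s _); apply: liftU.
suff fz0 : stage_map s (lker_val z) = 0 by rewrite linearZ_LR fz0 scaler0.
by case: z => z zK; apply/eqP.
Qed.

Lemma proj_resolution_exists (N : lmodType R) : inhabited (proj_resolution N).
Proof.
pose s0 := @ResStage N N (fglift (id : N -> N)).
pose s := fix s i := if i is j.+1 then next_stage (s j) else s0.
split; apply: (@ProjResolution R N (fun i => {freeg (stage_src (s i)) / R})
  (fun i => stage_map (s i.+1)) (stage_map s0)).
- by move=> i; apply: free_projective.
- by move=> z; exists << z >>; rewrite /= liftU scale1r.
- exact: (@next_stage_exact s0).
- by move=> i; exact: (@next_stage_exact (s i.+1)).
Qed.

End ResolutionExists.

Section Depth.
Variables (R : comNzRingType) (m : ideal R) (M : lmodType R).

(* None stands for +oo. *)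
Definition depth : option nat :=
  match pselect (exists d, `[< Ext_neq0 d (lquot m) M >]) with
  | left h => Some (ex_minn h)
  | right _ => None
  end.

End Depth.

Definition le_depth (q : nat) (d : option nat) : Prop :=
  if d is Some d' then (q <= d')%N else True.

Section InitiallyRegular.
Variables (k : fieldType) (n : nat).
Local Notation R := {mpoly k[n]}.

Record term_order := TermOrder {
  term_le :> rel 'X_{1..n};
  term_le_anti : antisymmetric term_le;
  term_le_trans : transitive term_le;
  term_le_total : total term_le;
  term_le_add : forall m m1 m2,
    term_le m1 m2 -> term_le (m1 + m)%MM (m2 + m)%MM;
  term_le0 : forall m, term_le 0%MM m
}.

Definition is_lead_monom (o : term_order) (f : R) (m : 'X_{1..n}) : Prop :=
  m \in msupp f /\ {in msupp f, forall m', o m' m}.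

Definition initial_ideal (o : term_order) (J : ideal R) : ideal R :=
  ideal_gen [set g : R | exists f m,
    [/\ f \in J, is_lead_monom o f m & g = 'X_[m]]].

Definition var_ideal : ideal R := ideal_gen [set g : R | exists i, g = 'X_i].

(* Indices are shifted by one: step_ideal o I f i is I_(i+1), built from the
   orders o 0, ..., o i and the polynomials f 0, ..., f (i-1). *)
Fixpoint step_ideal (o : nat -> term_order) (I : ideal R) (f : nat -> R)
    (i : nat) : ideal R :=
  match i with
  | 0 => initial_ideal (o 0) I
  | j.+1 => initial_ideal (o j.+1) (ideal_adjoin (step_ideal o I f j) (f j))
  end.

Definition initially_regular (q : nat) (o : nat -> term_order) (I : ideal R)
    (f : nat -> R) : Prop :=
  forall i, (i < q)%N ->
    [/\ ~ (exists c : k, f i = c%:MP), f i \in var_ideal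
      & regular_on (f i) (lquot (step_ideal o I f i))].

End InitiallyRegular.

(* Main.v *)
(** The depth is read off the Koszul cochain complex of the variables. If it is
    exact on [R/I] in degrees below [q], then [Ext^d(R/m, R/I) = 0] for [d < q]:
    [Ext^d(R/m, -)] is killed by the variables, hence by the Koszul
    differential, and a zigzag between a projective resolution and the Koszul
    complex kills each class in turn. Give the cochain with entry [x^a] at [T]
    the multidegree [a] plus the exponent of the product of the variables
    outside [T]; the Koszul differential preserves it. Comparing top multidegree
    parts, exactness modulo [in(J)] in a given degree gives exactness modulo
    [J] in that degree, by induction along the well-order of the monomials.
    Finally, [f] in [m] is null-homotopic on the Koszul complex, so if [f] is
    regular on [R/J], exactness modulo [(J, f)] below degree [r] gives exactness
    modulo [J] below degree [r + 1]. The two steps alternate along the sequence,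
    from [I_q] down to [I]. *)

Require Import Defs.
From HB Require Import structures.
From mathcomp Require Import all_boot all_order all_algebra.
From mathcomp Require Import boolp classical_sets.
From mathcomp Require Import generic_quotient mpoly ring.

Set Implicit Arguments.
Unset Strict Implicit.
Unset Printing Implicit Defensive.

Import GRing.Theory.
Local Open Scope ring_scope.
Local Open Scope quotient_scope.

(** * Submodules and spans *)

Section Submodules.
Variables (R : nzRingType) (V : lmodType R).

Lemma submodN (S : submodClosed V) x : x \in S -> - x \in S.
Proof. by move=> xS; rewrite -scaleN1r; apply: rpredZ. Qed.

Lemma submodB (S : submodClosed V) x y : x \in S -> y \in S -> x - y \in S.
Proof. by move=> xS yS; apply: rpredD => //; apply: submodN. Qed.

(** The span is an intersection of submodules, and [Q], made boolean, carries one of them. *)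
Lemma submod_span_ind (A : set V) (Q : V -> Prop) :
    Q 0 -> (forall x y, Q x -> Q y -> Q (x + y)) ->
    (forall a x, Q x -> Q (a *: x)) -> (forall x, A x -> Q x) ->
  forall x, x \in submod_span A -> Q x.
Proof.
move=> Q0 QD QZ QA x; pose p : {pred V} := fun v => `[< Q v >].
have pP : subsemimod_closed p.
  split; [split|] => [|u v /asboolP Qu /asboolP Qv|a v /asboolP Qv];
    apply/asboolP; [exact: Q0 | exact: QD | exact: QZ].
pose S : submodClosed V :=
  HB.pack p (GRing.isSubSemiModClosed.Build R V p pP).
move=> /asboolP /(_ S) xS; apply/asboolP/xS => a Aa.
by apply/asboolP/QA.
Qed.

Lemma mem_submod_span (A : set V) x : A x -> x \in submod_span A.
Proof. by move=> Ax; apply/asboolP => S; apply. Qed.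

End Submodules.

(** * Exterior multiplication, contraction and the Koszul cochain complex *)

Lemma sum_antisym (V : zmodType) n (a : 'I_n -> 'I_n -> V) :
  (forall i, a i i = 0) -> (forall i j, i != j -> a i j = - a j i) ->
  \sum_i \sum_j a i j = 0.
Proof.
move=> a0 aN.
(* The diagonal vanishes; the strictly lower and upper parts cancel once the order of summation is
   exchanged. *)
have -> : \sum_i \sum_j a i j =
    \sum_(i < n) \sum_(j < n | (j < i)%N) a i j +
    \sum_(i < n) \sum_(j < n | (i < j)%N) a i j.
  rewrite -big_split /=; apply: eq_bigr => i _.
  rewrite (bigID (fun j : 'I_n => (j < i)%N)) /=; congr (_ + _).
  rewrite (bigD1 i) ?ltnn //= a0 add0r; apply: eq_bigl => j.
  by rewrite -leqNgt ltn_neqAle andbC -(inj_eq val_inj) /= eq_sym.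
rewrite [X in _ + X](exchange_big_dep xpredT) //= -big_split big1 //= => i _.
rewrite -big_split big1 //= => j ji; rewrite aN ?addNr //.
by rewrite -(inj_eq val_inj) /= neq_ltn ji orbT.
Qed.

(* The cochain [z] stands for the sum of the [z T] times the exterior monomial
   [e_T]; then [ext_mul j] is [e_j /\ _] and [contract j] is the contraction
   against [e_j], whence the signs. *)
Section Koszul.
Variables (R : comNzRingType) (n : nat) (x : 'I_n -> R).

Definition ext_sign (j : 'I_n) (T : {set 'I_n}) : R :=
  (-1) ^+ #|[set i in T | (i < j)%N]|.

Lemma ext_signD1 i j (T : {set 'I_n}) : i \in T ->
  ext_sign j (T :\ i) = (-1) ^+ (i < j)%N * ext_sign j T.
Proof.
move=> iT; rewrite /ext_sign (cardsD1 i [set i in T | _]) inE iT /= exprD mulrA.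
rewrite -exprD addnn -mul2n exprM sqrrN expr1n expr1n mul1r.
by congr (_ ^+ #|pred_of_set _|); apply/setP => l; rewrite !inE andbA.
Qed.

Lemma ext_signU1 i j (T : {set 'I_n}) : i \notin T ->
  ext_sign j (i |: T) = (-1) ^+ (i < j)%N * ext_sign j T.
Proof.
move=> iT; rewrite -{2}(setU1K iT) ext_signD1 ?setU11 // mulrA -exprD addnn.
by rewrite -mul2n exprM sqrrN expr1n expr1n mul1r.
Qed.

Lemma ext_sign_sqr j T : ext_sign j T * ext_sign j T = 1.
Proof. by rewrite -expr2 -exprM mulnC exprM sqrrN expr1n expr1n. Qed.

Lemma sign_antisym (i j : 'I_n) : i != j ->
  (-1) ^+ (i < j)%N = - (-1) ^+ (j < i)%N :> R.
Proof.
by rewrite -(inj_eq val_inj) /=; case: ltngtP => //; rewrite expr1 expr0 ?opprK.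
Qed.

Section Operators.
Variable V : lmodType R.
Local Notation K := {ffun {set 'I_n} -> V}.

Definition ext_mul (j : 'I_n) (z : K) : K :=
  [ffun T : {set 'I_n} => if j \in T then ext_sign j T *: z (T :\ j) else 0].

Definition contract (j : 'I_n) (z : K) : K :=
  [ffun T : {set 'I_n} => if j \in T then 0 else ext_sign j T *: z (j |: T)].

(** A linear projection, used to make homogeneous the cochains obtained by entrywise choice or by
    lifting. *)
Definition restrict_deg (d : nat) (z : K) : K :=
  [ffun T : {set 'I_n} => if #|T| == d then z T else 0].

Definition kdiff (z : K) : K := \sum_j x j *: ext_mul j z.

Lemma ext_mul_is_linear j : linear (ext_mul j).
Proof.
move=> a z w; apply/ffunP => T; rewrite !ffunE.
by case: ifP => _; rewrite ?scaler0 ?addr0 // scalerDr !scalerA mulrC.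
Qed.
HB.instance Definition _ j :=
  GRing.isLinear.Build R K K _ (ext_mul j) (ext_mul_is_linear j).

Lemma contract_is_linear j : linear (contract j).
Proof.
move=> a z w; apply/ffunP => T; rewrite !ffunE.
by case: ifP => _; rewrite ?scaler0 ?addr0 // scalerDr !scalerA mulrC.
Qed.
HB.instance Definition _ j :=
  GRing.isLinear.Build R K K _ (contract j) (contract_is_linear j).

Lemma restrict_deg_is_linear d : linear (restrict_deg d).
Proof.
move=> a z w; apply/ffunP => T; rewrite !ffunE.
by case: ifP => _; rewrite ?scaler0 ?addr0.
Qed.
HB.instance Definition _ d :=
  GRing.isLinear.Build R K K _ (restrict_deg d) (restrict_deg_is_linear d).

Lemma kdiff_is_linear : linear kdiff.
Proof.
move=> a z w; rewrite /kdiff scaler_sumr -big_split /=; apply: eq_bigr => j _.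
by rewrite linearP scalerDr !scalerA mulrC.
Qed.
HB.instance Definition _ := GRing.isLinear.Build R K K _ kdiff kdiff_is_linear.

Lemma kdiffE z T :
  kdiff z T = \sum_(j in T) (x j * ext_sign j T) *: z (T :\ j).
Proof.
rewrite sum_ffunE [RHS]big_mkcond; apply: eq_bigr => j _; rewrite !ffunE.
by case: ifP; rewrite ?scaler0 ?scalerA.
Qed.

Lemma ext_mul_sqr j z : ext_mul j (ext_mul j z) = 0.
Proof.
by apply/ffunP => T; rewrite !ffunE !inE eqxx /= scaler0 if_same.
Qed.

Lemma ext_mulC i j z : i != j ->
  ext_mul i (ext_mul j z) = - ext_mul j (ext_mul i z).
Proof.
move=> ij; apply/ffunP => T; rewrite !ffunE !inE eq_sym (negbTE ij) /=.
case: (boolP (i \in T)) => iT; last first.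
  by rewrite scaler0 if_same oppr0.
case: (boolP (j \in T)) => jT; last by rewrite scaler0 oppr0.
rewrite !ext_signD1 // !scalerA -scaleNr finset.setDDl finset.setUC
  -finset.setDDl; congr (_ *: _).
by rewrite (sign_antisym ij); ring.
Qed.

(** With [contract_ext_mulC], the anticommutation rule of contraction and exterior multiplication.
    Here one of the two summands vanishes at each [T], according to whether [j \in T]. *)
Lemma contract_ext_mul j z :
  contract j (ext_mul j z) + ext_mul j (contract j z) = z.
Proof.
apply/ffunP => T; rewrite !ffunE !inE eqxx; case: ifP => jT.
  by rewrite add0r finset.setD1K // ext_signD1 // ltnn mul1r scalerA
    ext_sign_sqr scale1r.
by rewrite addr0 setU1K ?jT // ext_signU1 ?jT // ltnn mul1r scalerA
  ext_sign_sqr scale1r.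
Qed.

Lemma contract_ext_mulC i j z : i != j ->
  contract i (ext_mul j z) + ext_mul j (contract i z) = 0.
Proof.
move=> ij; have ji : j != i by rewrite eq_sym.
apply/ffunP => T; rewrite !ffunE !inE (negbTE ij) (negbTE ji) /=.
case: (boolP (j \in T)) => jT; case: (boolP (i \in T)) => iT /=;
  rewrite ?scaler0 ?addr0 //.
rewrite ext_signU1 // ext_signD1 // !scalerA (sign_antisym ij).
have -> : (i |: T) :\ j = i |: T :\ j.
  by apply/setP => l; rewrite !inE; case: eqP => // ->; rewrite (negbTE ji).
by rewrite -scalerDl [X in X *: _](_ : _ = 0) ?scale0r //; ring.
Qed.

Lemma kdiff_sqr z : kdiff (kdiff z) = 0.
Proof.
rewrite {1}/kdiff -[RHS](@sum_antisym _ n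
  (fun i j => (x i * x j) *: ext_mul i (ext_mul j z))).
- apply: eq_bigr => i _; rewrite linear_sum scaler_sumr.
  by apply: eq_bigr => j _; rewrite linearZ scalerA.
- by move=> i; rewrite ext_mul_sqr scaler0.
- by move=> i j ij; rewrite ext_mulC // scalerN mulrC.
Qed.

(** When [kdiff] is expanded, the terms of index other than [j] cancel by anticommutation. *)
Lemma kdiff_homotopy j z :
  kdiff (contract j z) + contract j (kdiff z) = x j *: z.
Proof.
rewrite /kdiff linear_sum -big_split (bigD1 j) //= linearZ -scalerDr.
rewrite [X in _ *: X]addrC [X in _ *: X]contract_ext_mul big1 ?addr0 // => i ij.
by rewrite linearZ /= -scalerDr addrC contract_ext_mulC 1?eq_sym // scaler0.
Qed.

Definition of_deg d (z : K) := forall T, z T != 0 -> #|T| = d.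

Lemma of_degD d z w : of_deg d z -> of_deg d w -> of_deg d (z + w).
Proof.
move=> zd wd T; rewrite ffunE; have [->|/zd //] := eqVneq (z T) 0.
by rewrite add0r => /wd.
Qed.

Lemma of_degZ d a z : of_deg d z -> of_deg d (a *: z).
Proof.
by move=> zd T; rewrite ffunE => H; apply: zd; apply: contraNneq H => ->;
  rewrite scaler0.
Qed.

Lemma of_degB d z w : of_deg d z -> of_deg d w -> of_deg d (z - w).
Proof. by move=> zd wd; rewrite -scaleN1r; apply: of_degD => //;
  apply: of_degZ. Qed.

Lemma of_deg_ext_mul d j z : of_deg d z -> of_deg d.+1 (ext_mul j z).
Proof.
move=> zd T; rewrite ffunE; case: ifP => [jT|]; last by rewrite eqxx.
move=> H; rewrite (cardsD1 j) jT add1n; congr _.+1; apply: zd.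
by apply: contraNneq H => ->; rewrite scaler0.
Qed.

Lemma of_deg_kdiff d z : of_deg d z -> of_deg d.+1 (kdiff z).
Proof.
move=> zd; rewrite /kdiff; apply: big_ind => [T|u v|j _].
- by rewrite ffunE eqxx.
- exact: of_degD.
- exact/of_degZ/of_deg_ext_mul.
Qed.

(* Degree [d - 1]; only the zero cochain qualifies at [d = 0]. *)
Definition of_pred_deg d (w : K) := forall T, w T != 0 -> #|T|.+1 = d.

Lemma of_pred_degS d w : of_pred_deg d.+1 w <-> of_deg d w.
Proof. by split=> wd T /wd => [[]|->]. Qed.

Lemma of_pred_deg0 w : of_pred_deg 0 w -> w = 0.
Proof.
by move=> w0; apply/ffunP => T; rewrite ffunE; apply/eqP/negPn/negP => /w0.
Qed.

Lemma of_pred_degD d z w : of_pred_deg d z -> of_pred_deg d w ->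
  of_pred_deg d (z + w).
Proof.
case: d => [|d]; first by move=> z0 /of_pred_deg0 ->; rewrite addr0.
by move=> /of_pred_degS zd /of_pred_degS wd; apply/of_pred_degS/of_degD.
Qed.

Lemma of_pred_degZ d a w : of_pred_deg d w -> of_pred_deg d (a *: w).
Proof.
by move=> wd T; rewrite ffunE => H; apply: wd; apply: contraNneq H => ->;
  rewrite scaler0.
Qed.

Lemma of_deg_kdiff_pred d w : of_pred_deg d w -> of_deg d (kdiff w).
Proof.
case: d => [/of_pred_deg0 -> T|d /of_pred_degS]; last exact: of_deg_kdiff.
by rewrite raddf0 ffunE eqxx.
Qed.

Lemma of_pred_deg_contract d j z : of_deg d z -> of_pred_deg d (contract j z).
Proof.
move=> zd T; rewrite ffunE; case: (boolP (j \in T)) => [|jT];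
  first by rewrite eqxx.
move=> H; rewrite -add1n -(zd (j |: T)) ?cardsU1 ?jT //.
by apply: contraNneq H => ->; rewrite scaler0.
Qed.

Lemma restrict_degP d z : of_deg d (restrict_deg d z).
Proof. by move=> T; rewrite ffunE; case: ifP => [/eqP //|_]; rewrite eqxx. Qed.

Lemma of_deg_eq0 d z (T : {set 'I_n}) : of_deg d z -> #|T| != d -> z T = 0.
Proof. by move=> zd; apply: contraNeq => /zd ->. Qed.

Lemma restrict_deg_id d z : of_deg d z -> restrict_deg d z = z.
Proof.
move=> zd; apply/ffunP => T; rewrite ffunE; case: eqP => // /eqP Td.
by rewrite (of_deg_eq0 zd Td).
Qed.

End Operators.

(** Exactness over [V / S], phrased on representatives so that coefficients of the entries stay
    accessible when [V] is a polynomial ring. *)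
Definition koszul_exact_mod (V : lmodType R) (S : submodClosed V) (d : nat) :=
  forall z : {ffun {set 'I_n} -> V}, of_deg d z ->
    (forall T, kdiff z T \in S) ->
    exists2 w, of_pred_deg d w & forall T, (z - kdiff w) T \in S.

Definition koszul_exact (V : lmodType R) (d : nat) :=
  forall z : {ffun {set 'I_n} -> V}, of_deg d z -> kdiff z = 0 ->
    exists2 w, of_pred_deg d w & z = kdiff w.

End Koszul.

(** * Koszul exactness modulo an ideal, and regular elements *)

Section Quotients.
Variables (R : comNzRingType) (n : nat) (x : 'I_n -> R).

Lemma lquot_eq0 (V : lmodType R) (S : submodClosed V) v :
  (\pi_(lquot S) v = 0) <-> (v \in S).
Proof.
rewrite -{2}[v]subr0; split=> [v0|/lquot_eqP ->]; last by rewrite raddf0.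
by apply/lquot_eqP; rewrite raddf0.
Qed.

Lemma koszul_exact_lquot (V : lmodType R) (S : submodClosed V) d :
  koszul_exact_mod x S d -> koszul_exact x (lquot S) d.
Proof.
move=> ex z zd Dz0.
pose p (y : {ffun {set 'I_n} -> V}) := [ffun T => \pi_(lquot S) (y T)].
have Dp y : kdiff x (p y) = p (kdiff x y).
  apply/ffunP => T; rewrite [RHS]ffunE !kdiffE raddf_sum.
  by apply: eq_bigr => j _; rewrite ffunE -pi_lquot_is_scalable.
(* [repr 0] need not be [0], so the representatives are truncated to degree [d]. *)
pose z1 := restrict_deg d [ffun T => repr (z T)].
have pz1 : p z1 = z.
  rewrite -[RHS](restrict_deg_id zd); apply/ffunP => T; rewrite !ffunE.
  by case: ifP => _; rewrite ?reprK ?raddf0.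
have [|T|w wd zw] := ex z1; first exact: restrict_degP.
  by apply/lquot_eq0; rewrite -[LHS]/(_ (kdiff x z1 T));
    move/ffunP/(_ T): (Dp z1);
     rewrite pz1 Dz0 !ffunE => <-.
exists (p w) => [T|]; first rewrite ffunE => H; first apply: wd.
  by apply: contraNneq H => ->; rewrite raddf0.
rewrite Dp -pz1; apply/ffunP => T; rewrite !ffunE; apply/lquot_eqP.
by have := zw T; rewrite !ffunE.
Qed.

Lemma regular_on_lquot (J : ideal R) f :
  regular_on f (lquot J) -> forall g, f * g \in J -> g \in J.
Proof.
move=> reg g fg; apply/lquot_eq0/reg.
by rewrite -pi_lquot_is_scalable; apply/lquot_eq0.
Qed.

Lemma ideal_adjoin_decomp (J : ideal R) f y :
  y \in ideal_adjoin J f -> exists a, y - a * f \in J.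
Proof.
move: y; apply: (@submod_span_ind R R^o _ (fun y => exists a, y - a * f \in J)).
- by exists 0; rewrite mul0r subr0 rpred0.
- move=> u v [a ua] [b vb]; exists (a + b).
  have -> : u + v - (a + b) * f = (u - a * f) + (v - b * f) by ring.
  exact: rpredD.
- move=> c u [a ua]; exists (c * a).
  have -> : c *: u - c * a * f = c *: (u - a * f :> R^o)
    by rewrite scalerBr -mulrA.
  exact: rpredZ.
- move=> u [uJ|->]; first by exists 0; rewrite mul0r subr0.
  by exists 1; rewrite mul1r subrr rpred0.
Qed.

(** For fixed [z], the [f] that admit such a [w] form an ideal; by [kdiff_homotopy] it contains
    [x j], with the contraction of [z] as [w]. *)
Lemma koszul_null_homotopic (f : R) (V : lmodType R) (S : submodClosed V) d z :
    f \in ideal_gen [set g | exists i, g = x i] ->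
    of_deg d z -> (forall T, kdiff x z T \in S) ->
  exists2 w, of_pred_deg d w & forall T, (f *: z - kdiff x w) T \in S.
Proof.
move=> + zd Dz; move: f.
apply: (@submod_span_ind R R^o _ (fun f : R => exists2 w,
  of_pred_deg d w & forall T, (f *: z - kdiff x w) T \in S)) => [|f g|a f|f].
- exists 0 => [T|T]; first by rewrite ffunE eqxx.
  by rewrite scale0r raddf0 subrr ffunE rpred0.
- move=> [u ud fu] [v vd gv]; exists (u + v); first exact: of_pred_degD.
  move=> T; rewrite scalerDl raddfD opprD addrACA ffunE.
  exact: rpredD.
- move=> [u ud fu]; exists (a *: u); first exact: of_pred_degZ.
  by move=> T; rewrite linearZ -scalerA -scalerBr ffunE; apply/rpredZ/fu.
- move=> [j ->]; exists (contract j z); first exact: of_pred_deg_contract.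
  move=> T; rewrite -kdiff_homotopy addrC addKr ffunE.
  by case: ifP => _; [exact: rpred0 | exact: rpredZ].
Qed.

(** As [f] is null-homotopic, [f *: z] is [kdiff x w] modulo [J], so [w] is a cocycle modulo
    [(J, f)]. Exactness one degree lower gives [w = kdiff x u + f *: v] modulo [J]. Then [f] kills
    [z - kdiff x v] modulo [J], and regularity cancels [f]. *)
Lemma koszul_exact_regular (J : ideal R) f d :
    f \in ideal_gen [set g | exists i, g = x i] ->
    (forall g, f * g \in J -> g \in J) ->
    (forall e, (e < d)%N -> koszul_exact_mod x (ideal_adjoin J f) e) ->
  koszul_exact_mod x J d.
Proof.
move=> fx reg ex z zd Dz.
have [w wd fz] := koszul_null_homotopic fx zd Dz.
(* In degree 0 the cochain [w] is zero, so [f *: z] itself has entries in [J]. *)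
case: d => [|d] in zd wd ex *.
  exists 0 => T; first by rewrite ffunE eqxx.
  rewrite raddf0 subr0; apply: reg; have := fz T.
  by rewrite (of_pred_deg0 wd) raddf0 subr0 ffunE.
have [|T|u ud wu] := ex d (ltnSn d) w; first exact/of_pred_degS.
  have -> : kdiff x w T = f * z T - (f *: z - kdiff x w) T.
    by rewrite !ffunE [f *: z T]/(f * z T) subKr.
  apply: submodB; last by apply: mem_submod_span; left; apply: fz.
  rewrite mulrC; apply: (@rpredZ _ R^o); apply: mem_submod_span; by right.
have [v0 v0P] := choice (fun T => ideal_adjoin_decomp (wu T)).
pose v : {ffun {set 'I_n} -> R^o} :=
  restrict_deg d [ffun T : {set 'I_n} => (v0 T : R^o)].
have vP T : (w - kdiff x u - f *: v) T \in J.
  have [Td|Td] := eqVneq #|T| d.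
    by have := v0P T; rewrite !ffunE Td eqxx [f *: _]mulrC.
  have wd' : of_deg d (w - kdiff x u).
    by apply: of_degB; [exact/of_pred_degS | exact: of_deg_kdiff_pred].
  by rewrite ffunE (of_deg_eq0 wd' Td) !ffunE (negbTE Td) scaler0 subrr rpred0.
exists v => [|T]; first by apply/of_pred_degS/restrict_degP.
apply: reg.
have -> : f * (z - kdiff x v) T =
    (f *: z - kdiff x w) T + kdiff x (w - kdiff x u - f *: v) T.
  rewrite !raddfB /= kdiff_sqr subr0 linearZ !ffunE mulrBr.
  by rewrite addrA subrK.
apply: rpredD => //; rewrite kdiffE; elim/big_ind: _ => [|a b|j _].
- exact: rpred0.
- exact: rpredD.
- exact: rpredZ.
Qed.
End Quotients.

(** * From Koszul exactness to the vanishing of Ext *)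

Lemma linear_bundle (R : nzRingType) (A B : lmodType R) (f : A -> B) :
  linear f -> exists g : {linear A -> B}, g =1 f.
Proof.
move=> fP.
by exists (HB.pack_for {linear A -> B} f (GRing.isLinear.Build R A B _ f fP)).
Qed.

(** The pullback of [g] and [f], realised as a kernel in [A * Q], surjects onto [Q]; a section of it
    followed by the first projection is the lift. *)
Lemma projective_lift (R : nzRingType) (Q A C : lmodType R)
    (g : {linear A -> C}) (f : {linear Q -> C}) :
    projective Q -> (forall p, exists a, g a = f p) ->
  exists h : {linear Q -> A}, forall p, g (h p) = f p.
Proof.
move=> projQ fg.
have [k kE] : exists k : {linear (A * Q)%type -> C},
  forall u, k u = g u.1 - f u.2.
  apply: linear_bundle => a u v /=.
  by rewrite !linearP scalerDr addrACA.
have [pr prE] : exists pr : {linear lker_type k -> Q},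
  forall u, pr u = (\val u).2.
  by apply: linear_bundle => a u v; rewrite linearP.
have [|s sP] := projQ _ _ pr (idfun : {linear Q -> Q}).
  move=> p; have [a ga] := fg p.
  have kap : (a, p) \in lker_pred k by rewrite inE kE ga subrr.
  by exists (LkerType kap); rewrite prE.
have [h hE] : exists h : {linear Q -> A}, forall p, h p = (\val (s p)).1.
  by apply: linear_bundle => a u v /=; rewrite !linearP.
exists h => p; rewrite hE; apply/eqP; rewrite -subr_eq0.
have := sP p; rewrite prE /= => {2}<-; rewrite -kE.
exact: (valP (s p)).
Qed.

Section KoszulExt.
Variables (R : comNzRingType) (n : nat) (x : 'I_n -> R) (N M : lmodType R).
Hypothesis xN : forall j (v : N), x j *: v = 0.
Variable P : proj_resolution N.
Local Notation d_ := (res_diff P).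
Local Notation K := {ffun {set 'I_n} -> M}.

Lemma res_diff_diff a y : d_ a (d_ a.+1 y) = 0.
Proof. by apply/res_exactS; exists y. Qed.

(* Multiplication by [x j] is null-homotopic on [P]; only the composite of the
   homotopy identity with [d_ a] is needed. *)
Lemma res_homotopy j a : exists h : {linear P a -> P a.+1},
  forall y, d_ a (h (d_ a y)) = x j *: d_ a y.
Proof.
elim: a => [|a [h hP]].
  have [g gE] : exists g : {linear P 0 -> P 0}, forall p, g p = x j *: p.
    by apply: linear_bundle => b u v; rewrite scalerDr !scalerA mulrC.
  have [|h hP] := projective_lift (g := d_ 0) (f := g)
    (@res_projective _ _ P 0%N).
    by move=> p; apply/res_exact0; rewrite gE linearZ_LR xN.
  by exists h => y; rewrite hP gE.
(* By the induction hypothesis [d_ a] kills the image of [g], so [g] lifts through the next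
   differential. *)
have [g gE] : exists g : {linear P a.+1 -> P a.+1},
  forall p, g p = x j *: p - h (d_ a p).
  apply: linear_bundle => b u v /=;
    rewrite (linearP (d_ a)) (linearP h) scalerBr opprD addrACA.
  by rewrite scalerDr !scalerA mulrC.
have [|h' hP'] := projective_lift (g := d_ a.+1) (f := g)
  (@res_projective _ _ P a.+1).
  by move=> p; apply/res_exactS; rewrite gE raddfB /= linearZ_LR hP subrr.
by exists h' => y; rewrite hP' gE res_diff_diff raddf0 subr0.
Qed.

Definition ext_vanishes (a : nat) :=
  forall phi : {linear P a -> M}, cocycle phi -> coboundary phi.

Lemma ext_vanishes0_cochain (phi : {linear P 0 -> K}) : ext_vanishes 0 ->
  (forall y, phi (d_ 0 y) = 0) -> forall p, phi p = 0.
Proof.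
move=> ext0 phid p; apply/ffunP => T; rewrite ffunE.
have [f fE] : exists f : {linear P 0 -> M}, forall p, f p = phi p T.
  by apply: linear_bundle => a u v; rewrite linearP !ffunE.
by rewrite -fE; apply: (ext0 f) => y; rewrite fE phid ffunE.
Qed.

(** A [K]-valued cochain is a finite family of [M]-valued ones, so the vanishing of Ext applies
    entry by entry. *)
Lemma ext_vanishesS_cochain a b (phi : {linear P a.+1 -> K}) :
    ext_vanishes a.+1 -> (forall y, phi (d_ a.+1 y) = 0) ->
    (forall p, of_deg b (phi p)) ->
  exists2 psi : {linear P a -> K},
    forall p, of_deg b (psi p) & forall p, phi p = psi (d_ a p).
Proof.
move=> exta phid phib.
have /choice [psi psiP] T : exists f : {linear P a -> M},
  forall p, phi p T = f (d_ a p).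
  have [f fE] : exists f : {linear P a.+1 -> M}, forall p, f p = phi p T.
    by apply: linear_bundle => c u v; rewrite linearP !ffunE.
  have [|g gP] := exta f; first by move=> y; rewrite fE phid ffunE.
  by exists g => p; rewrite -fE gP.
have [Psi PsiE] : exists Psi : {linear P a -> K}, forall p, Psi p =
    restrict_deg b [ffun T : {set 'I_n} => psi T p].
  apply: linear_bundle => c u v; rewrite -linearP; congr restrict_deg.
  by apply/ffunP => T; rewrite !ffunE linearP.
exists Psi => p; first by rewrite PsiE; apply: restrict_degP.
by rewrite PsiE -[LHS](restrict_deg_id (phib p)); congr restrict_deg;
   apply/ffunP => T; rewrite ffunE psiP.
Qed.

(** Projectivity makes the pointwise preimages linear; lifting through [kdiff x] composed with
    [restrict_deg d] lets the lift be cut down to degree [d]. *)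
Lemma koszul_lift a d (phi : {linear P a -> K}) :
    koszul_exact x M d.+1 -> (forall p, of_deg d.+1 (phi p)) ->
    (forall p, kdiff x (phi p) = 0) ->
  exists2 psi : {linear P a -> K},
    forall p, of_deg d (psi p) & forall p, phi p = kdiff x (psi p).
Proof.
move=> ex phid Dphi.
have [|h hP] := projective_lift
  (g := @kdiff R n x M \o @restrict_deg R n M d) (f := phi)
  (@res_projective _ _ P a).
  move=> p; have [w /of_pred_degS wd ->] := ex _ (phid p) (Dphi p).
  by exists w; rewrite /= restrict_deg_id.
by exists (@restrict_deg R n M d \o h) => p;
  [exact: restrict_degP | rewrite -hP].
Qed.

Variable q : nat.
Hypothesis exM : forall d, (d < q)%N -> koszul_exact x M d.

(** The composite of [kdiff x] with [psi] kills boundaries: it is zero at [a = 0] and otherwise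
    factors as [chi0] after the differential. Recursion, one down in [a] and one up in [b], replaces
    [chi0] by a Koszul cocycle [chi], which exactness writes as [kdiff x] after [omega]. Subtracting
    from [psi] the composite of [omega] with the differential makes it a cocycle. *)
Lemma cocycle_lift a b (psi : {linear P a -> K}) :
    (forall c, (c <= a)%N -> ext_vanishes c) -> (a + b < q)%N ->
    (forall p, of_deg b (psi p)) -> (forall y, kdiff x (psi (d_ a y)) = 0) ->
  exists psi' : {linear P a -> K}, [/\ forall p, of_deg b (psi' p),
    forall p, kdiff x (psi' p) = 0 & forall y, psi' (d_ a y) = psi (d_ a y)].
Proof.
elim: a b psi => [|a IH] b psi ext abq psib Dpsi.
  exists psi; split=> //.
  exact: (@ext_vanishes0_cochain (@kdiff R n x M \o psi) (ext 0 (leqnn 0))).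
have [||chi0 chi0b chi0P] :=
  @ext_vanishesS_cochain a b.+1 (@kdiff R n x M \o psi) (ext _ (leqnn _)).
- exact: Dpsi.
- by move=> p; apply/of_deg_kdiff/psib.
have [||||chi [chib Dchi chiP]] := IH b.+1 chi0.
- by move=> c ca; apply/ext/leqW.
- by rewrite addnS.
- exact: chi0b.
- by move=> y; rewrite -chi0P /= kdiff_sqr.
have [|omega omegab omegaP] := koszul_lift (exM _) chib Dchi.
  by apply: leq_ltn_trans abq; rewrite addSn ltnS leq_addl.
have [psi' psiE] : exists psi' : {linear P a.+1 -> K}, forall p,
    psi' p = psi p - omega (d_ a p).
  by apply: linear_bundle => c u v; rewrite !linearP scalerDr addrACA.
exists psi'; split=> p; rewrite psiE.
- exact: of_degB.
- by rewrite raddfB /= -omegaP chiP -chi0P subrr.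
- by rewrite res_diff_diff raddf0 subr0.
Qed.

Theorem koszul_ext_vanishes a : (a < q)%N -> ext_vanishes a.
Proof.
have [m le_am] := ubnP a; elim: m a le_am => // m IH a;
  rewrite ltnS => am aq phi phid.
(* [phi] is placed in Koszul degree 0, at the empty set. *)
have [Phi PhiE] : exists Phi : {linear P a -> K}, forall p,
    Phi p = [ffun T : {set 'I_n} => if T == finset.set0 then phi p else 0].
  apply: linear_bundle => c u v; apply/ffunP => T; rewrite !ffunE.
  by case: eqP => _; rewrite ?linearP // scaler0 addr0.
have Phi0 p : of_deg 0 (Phi p).
  by move=> T; rewrite PhiE ffunE; case: ifP => [/eqP ->|_];
    rewrite ?cards0 ?eqxx.
have Phid y : Phi (d_ a y) = 0.
  by apply/ffunP => T; rewrite PhiE !ffunE phid if_same.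
(* Exactness in degree 0 means that [kdiff x] is injective there. *)
have inj z : of_deg 0 z -> kdiff x z = 0 -> z = 0 :> K.
  move=> z0 Dz; have [|w /of_pred_deg0 -> ->] := exM _ z0 Dz.
    exact: leq_ltn_trans aq.
  by rewrite raddf0.
have at0 p : phi p = Phi p finset.set0 by rewrite PhiE ffunE eqxx.
case: a => [|a] in am aq phi phid Phi PhiE Phi0 Phid at0 *.
  move=> p; rewrite at0 (inj (Phi p)) ?ffunE // /kdiff big1 // => j _.
  rewrite -linearZ /= -linearZ /=.
  (* In degree 0, [x j *: p] is killed by the augmentation, hence is a boundary, on which [Phi]
     vanishes. *)
  have /res_exact0 [y <-] : res_aug P (x j *: p) = 0 by rewrite linearZ_LR xN.
  by rewrite Phid raddf0.
have [h hP] := choice (fun j => res_homotopy j a).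
have hPhi j p : Phi (x j *: p) = Phi (h j (d_ a p)).
  apply/eqP; rewrite -subr_eq0 -raddfB; apply/eqP.
  have /res_exactS [y <-] : d_ a (x j *: p - h j (d_ a p)) = 0.
    by rewrite raddfB /= linearZ_LR hP subrr.
  exact: Phid.
(* By [hPhi], [kdiff x (Phi p)] depends on [d_ a p] only; [psi0] is the resulting factor. *)
have [psi0 psi0E] : exists psi0 : {linear P a -> K}, forall p,
    psi0 p = \sum_j ext_mul j (Phi (h j p)).
  apply: linear_bundle => c u v; rewrite scaler_sumr -big_split.
  by apply: eq_bigr => j _; rewrite !linearP.
have psi0d p : psi0 (d_ a p) = kdiff x (Phi p).
  rewrite psi0E; apply: eq_bigr => j _.
  by rewrite -hPhi !linearZ.
have [||||psi [psi1 Dpsi psiP]] := @cocycle_lift a 1 psi0.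
- by move=> c ca; apply: IH; apply: leq_ltn_trans ca _ => //; apply: ltnW.
- by rewrite addn1.
- move=> p; rewrite psi0E; apply: big_ind => [T|u v|j _].
  + by rewrite ffunE eqxx.
  + exact: of_degD.
  + exact: of_deg_ext_mul.
- by move=> y; rewrite psi0d kdiff_sqr.
(* The degree 1 cocycle [psi] is [kdiff x] after [theta]; then [Phi p - theta (d_ a p)] is a cocycle
   of degree 0, hence zero. *)
have [|theta theta0 thetaP] := koszul_lift (exM _) psi1 Dpsi.
  exact: leq_ltn_trans aq.
have [f fE] : exists f : {linear P a -> M}, forall p, f p = theta p finset.set0.
  by apply: linear_bundle => c u v; rewrite linearP !ffunE.
exists f => p; rewrite fE at0; suff -> : Phi p = theta (d_ a p) by [].
apply/eqP; rewrite -subr_eq0; apply/eqP/inj; first exact: of_degB.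
by rewrite raddfB /= -thetaP psiP psi0d subrr.
Qed.

End KoszulExt.

Lemma koszul_not_Ext (R : comNzRingType) n (x : 'I_n -> R)
    (N M : lmodType R) q :
    (forall j (v : N), x j *: v = 0) ->
    (forall d, (d < q)%N -> koszul_exact x M d) ->
  forall d, (d < q)%N -> ~ Ext_neq0 d N M.
Proof.
move=> xN ex d dq [P [phi [phiZ phiB]]]; apply: phiB.
exact: (koszul_ext_vanishes xN ex dq phiZ).
Qed.

(** * Dickson's lemma *)

Lemma nondecreasing_subseq (v : nat -> nat) : exists s : nat -> nat,
  (forall i, s i < s i.+1)%N /\ (forall i j, i <= j -> v (s i) <= v (s j))%N.
Proof.
(* [g N] is an index at or beyond [N] where [v] is minimal among all such indices. *)
have /choice [g gP] N : exists i, (N <= i)%N /\ forall j, (N <= j)%N ->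
  (v i <= v j)%N.
  have ex0 : exists m, `[< exists2 i, (N <= i)%N & v i = m >].
    by exists (v N); apply/asboolP; exists N.
  case: (ex_minnP ex0) => m /asboolP [i Ni <-] min.
  by exists i; split=> // j Nj; apply: min; apply/asboolP; exists j.
pose s := fix s i := if i is i'.+1 then g (s i').+1 else g 0%N.
have s_lt i : (s i < s i.+1)%N by case: (gP (s i).+1).
exists s; split=> // i j ij.
have le_s : (s i <= s j)%N.
  by apply: (homo_leq leqnn leq_trans) ij => l; apply: ltnW.
by case: i ij le_s => [|i] _ le_s; apply: (gP _).2 => //;
  apply: leq_trans le_s; apply: (gP _).1.
Qed.

(** The sequence is thinned out one variable at a time; any two remaining terms then compare. *)
Lemma dickson n (u : nat -> 'X_{1..n}) :
  exists i j, (i < j)%N /\ (u i <= u j)%MM.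
Proof.
have [s [s_lt sP]] : exists s : nat -> nat, (forall i, s i < s i.+1)%N /\
    {in enum 'I_n, forall l i j, i <= j -> u (s i) l <= u (s j) l}%N.
  elim: (enum 'I_n) => [|l r [s [s_lt sP]]]; first by exists id.
  have [t [t_lt tP]] := nondecreasing_subseq (fun i => u (s i) l).
  exists (s \o t); split=> [i /=|l' + i j ij /=].
    by apply: (homo_ltn ltn_trans s_lt); apply: t_lt.
  rewrite inE => /predU1P [->|l'r]; first exact: tP.
  by apply: sP => //; apply: (homo_leq leqnn leq_trans) ij => m; apply: ltnW.
exists (s 0%N), (s 1%N); split=> //.
by apply/mnm_lepP => l; apply: sP; rewrite ?mem_enum.
Qed.

(** * Term orders and initial ideals *)

Section TermOrder.
Variables (n : nat) (o : term_order n).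

Definition term_lt (m1 m2 : 'X_{1..n}) := o m1 m2 && (m1 != m2).

Lemma term_lt_trans : transitive term_lt.
Proof.
move=> m2 m1 m3 /andP [m12 ne12] /andP [m23 ne23].
rewrite /term_lt (term_le_trans m12 m23); apply: contraNneq ne12 => e.
by apply/eqP/(@term_le_anti _ o); rewrite m12 e.
Qed.

Lemma term_le_lem m1 m2 : (m1 <= m2)%MM -> o m1 m2.
Proof.
by move=> /submK <-; rewrite -{1}[m1]add0m; apply/term_le_add/term_le0.
Qed.

(** A non-accessible monomial starts an infinite strict descent, in which Dickson's lemma finds a
    term dividing a later one; divisibility implies [o], a contradiction. *)
Lemma term_lt_wf : well_founded term_lt.
Proof.
move=> m; apply: contrapT => nm.
have /choice [g gP] (a : {m | ~ Acc term_lt m}) :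
    exists b : {m | ~ Acc term_lt m}, term_lt (sval b) (sval a).
  case: a => a na; apply: contrapT => nb; apply: (na); constructor => b ba.
  by apply: contrapT => bn; apply: nb; exists (exist _ b bn).
pose s i := sval (iter i g (exist _ m nm)).
have s_lt i j : (i < j)%N -> term_lt (s j) (s i).
  apply: (homo_ltn (r := fun a b => term_lt b a)) => [b a c ab bc|l].
    exact: term_lt_trans bc ab.
  exact: gP.
have [i [j [ij /term_le_lem sij]]] := dickson s.
have /andP [sji /eqP[]] := s_lt _ _ ij.
by apply: (@term_le_anti _ o); rewrite sij sji.
Qed.

Lemma exists_term_max (r : seq 'X_{1..n}) : r != [::] ->
  exists2 m, m \in r & {in r, forall m', o m' m}.
Proof.
elim: r => // a [_ _|b r IH _].
  by exists a; rewrite ?mem_head // => m'; rewrite inE => /eqP->;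
    apply: term_le_lem (lepm_refl _).
have [//|m mr mmax] := IH; have [am|ma] := orP (term_le_total o a m).
  exists m; first by rewrite inE mr orbT.
  by move=> m'; rewrite inE => /predU1P [->|/mmax].
exists a; first exact: mem_head.
move=> m'; rewrite inE => /predU1P [->|/mmax m'm].
  exact: term_le_lem (lepm_refl _).
exact: term_le_trans m'm ma.
Qed.

Lemma term_le_addI m m1 m2 : o (m1 + m)%MM (m2 + m)%MM -> o m1 m2.
Proof.
move=> le12; have [//|le21] := orP (term_le_total o m1 m2).
have e : (m1 + m = m2 + m)%MM.
  by apply: (@term_le_anti _ o); rewrite le12 term_le_add.
by rewrite (addIm e); apply: term_le_lem (lepm_refl _).
Qed.

Variable k : fieldType.
Local Notation R := {mpoly k[n]}.

Lemma is_lead_monomMX (f : R) m m' :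
  is_lead_monom o f m -> is_lead_monom o (f * 'X_[m']) (m' + m)%MM.
Proof.
move=> [mf lead]; split; first by rewrite (perm_mem (msuppMX _ _)) map_f.
move=> l; rewrite (perm_mem (msuppMX _ _)) => /mapP [l' l'f ->].
by rewrite ![(m' + _)%MM]addmC; apply/term_le_add/lead.
Qed.

(** This holds for the generators and passes to sums, which create no new monomials. A monomial of a
    multiple [a * p] is one of [p] shifted by some [m1], and [g * 'X_[m1]] serves for it. *)
Lemma initial_ideal_lead (J : ideal R) p m :
    p \in initial_ideal o J -> m \in msupp p ->
  exists2 g : R, g \in J & is_lead_monom o g m.
Proof.
move=> + ; move: p m.
suff H p : p \in initial_ideal o J -> forall m, m \in msupp p ->
   exists2 g : R, g \in J & is_lead_monom o g m by move=> p m /H; apply.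
move: p; apply: (@submod_span_ind R R^o _ (fun p : R =>
  forall m, m \in msupp p ->
   exists2 g : R, g \in J & is_lead_monom o g m)).
- by move=> m; rewrite msupp0.
- move=> p q IHp IHq m /msuppD_le; rewrite mem_cat => /orP [/IHp|/IHq] //.
- move=> a p IHp m /msuppM_le /allpairsP [[m1 m2] /= [_ /IHp [g gJ gm] ->]].
  exists (g * 'X_[m1]); last exact: is_lead_monomMX.
  by rewrite mulrC; apply: (@rpredZ _ R^o).
- move=> p [f [m [fJ fm ->]]] m'; rewrite msuppX inE => /eqP ->.
  by exists f.
Qed.

(** A witness from [initial_ideal_lead] is rescaled to have coefficient [p@_m] at [m]. The clause
    for [p@_m = 0] keeps cochains built entrywise homogeneous. *)
Lemma initial_ideal_lift (J : ideal R) p m : p \in initial_ideal o J ->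
  exists g : R, [/\ g \in J, p@_m = 0 -> g = 0 &
    forall m', (p@_m *: 'X_[m] - g)@_m' != 0 -> term_lt m' m].
Proof.
move=> pJ; have [p0|pm] := eqVneq p@_m 0.
  exists 0; split=> // [|m']; first exact: rpred0.
  by rewrite p0 scale0r subr0 mcoeff0 eqxx.
have [|g gJ [mg lead]] := initial_ideal_lead (m := m) pJ.
  by rewrite mcoeff_msupp.
have gm : g@_m != 0 by rewrite -mcoeff_msupp.
exists ((p@_m / g@_m) *: g); split=> [|p0|m' nz].
- by rewrite -mul_mpolyC; apply: (@rpredZ _ R^o).
- by rewrite p0 eqxx in pm.
rewrite mcoeffB !mcoeffZ mcoeffX in nz; have [mm'|ne] := eqVneq m m'.
  by rewrite -mm' eqxx mulr1 divfK // subrr eqxx in nz.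
rewrite /term_lt eq_sym ne andbT; apply: lead; rewrite mcoeff_msupp.
by apply: contraNneq nz => ->; rewrite (negbTE ne) !mulr0 subrr.
Qed.

End TermOrder.

(** * Koszul exactness passes from the initial ideal to the ideal *)

Section Semicontinuity.
Variables (k : fieldType) (n : nat).
Local Notation R := {mpoly k[n]}.
Local Notation K := {ffun {set 'I_n} -> R^o}.
Local Notation D := (@kdiff R n (fun i => 'X_i) R^o).

Definition cmpl_mnm (T : {set 'I_n}) : 'X_{1..n} :=
  [multinom (i \notin T : nat) | i < n].

(** This is why the differential preserves multidegree: adjoining [j] to the index set loses a
    factor that multiplication by ['X_j] restores. *)
Lemma cmpl_mnmD1 j (T : {set 'I_n}) : j \in T ->
  cmpl_mnm (T :\ j) = (cmpl_mnm T + U_(j))%MM.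
Proof.
move=> jT; apply/mnmP => i; rewrite mnmDE mnm1E !mnmE !inE.
by have [->|ne] := eqVneq i j; rewrite ?jT /= ?addn0.
Qed.

(* The component of multidegree [m], where [x^a e_T] has multidegree
   [a + cmpl_mnm T]. *)
Definition fine_part (m : 'X_{1..n}) (z : K) : K :=
  [ffun T : {set 'I_n} => (if (cmpl_mnm T <= m)%MM then
     (z T : R)@_(m - cmpl_mnm T) *: ('X_[m - cmpl_mnm T] : R) else 0) : R^o].

Lemma fine_part_is_zmod m : zmod_morphism (fine_part m).
Proof.
move=> z w; apply/ffunP => T; rewrite !ffunE.
by case: ifP => _; rewrite ?subr0 // mcoeffB scalerBl.
Qed.
HB.instance Definition _ m :=
  GRing.isZmodMorphism.Build K K (fine_part m) (fine_part_is_zmod m).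

Lemma mul_fine_part m z T : (fine_part m z T : R) * 'X_[cmpl_mnm T] =
  ((z T : R) * 'X_[cmpl_mnm T])@_m *: 'X_[m].
Proof.
rewrite ffunE; case: ifP => [le|/negbT nle].
  rewrite -scalerAl -mpolyXD submK //; congr (_ *: _).
  by rewrite -[in RHS](submK le) addmC mcoeffMX.
rewrite mul0r; case: (eqVneq (((z T : R) * 'X_[cmpl_mnm T])@_m) 0) => [->|].
  by rewrite scale0r.
rewrite -mcoeff_msupp (perm_mem (msuppMX _ _)) => /mapP [m' _ e].
by rewrite e lem_addr in nle.
Qed.

(** Once entry [T] is multiplied by ['X_[cmpl_mnm T]], the differential has only signs as
    coefficients, and these commute with taking the part at [m]. *)
Lemma mul_kdiff z T : (D z T : R) * 'X_[cmpl_mnm T] =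
  \sum_(j in T) ext_sign R j T * ((z (T :\ j) : R) * 'X_[cmpl_mnm (T :\ j)]).
Proof.
rewrite (kdiffE (fun i => 'X_i) z T) mulr_suml; apply: eq_bigr => j jT.
rewrite cmpl_mnmD1 // mpolyXD /GRing.scale /=; ring.
Qed.

Lemma kdiff_fine_part m z : D (fine_part m z) = fine_part m (D z).
Proof.
apply/ffunP => T.
suff : (D (fine_part m z) T : R) * 'X_[cmpl_mnm T] =
       (fine_part m (D z) T : R) * 'X_[cmpl_mnm T].
  by apply: mulIf; rewrite -msupp_eq0 msuppX.
apply: etrans (mul_kdiff (fine_part m z) T) _.
apply: etrans (esym (mul_fine_part m (D z) T)).
rewrite [in RHS]mul_kdiff raddf_sum scaler_suml; apply: eq_bigr => j _.
rewrite (mul_fine_part m z (T :\ j)) /ext_sign -signr_odd.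
by case: (odd _); rewrite ?mulN1r ?mul1r // raddfN scaleNr.
Qed.

Lemma fine_part_id m z : fine_part m (fine_part m z) = fine_part m z.
Proof.
apply/ffunP => T; rewrite !ffunE; case: (boolP (_ <= m)%MM) => // _.
by rewrite mcoeffZ mcoeffX eqxx mulr1.
Qed.

Lemma fine_part_orth m m' z : m != m' -> fine_part m (fine_part m' z) = 0.
Proof.
move=> ne; apply/ffunP => T; rewrite !ffunE; case: ifP => // le.
case: ifP => [le'|]; last by rewrite mcoeff0 scale0r.
rewrite mcoeffZ mcoeffX; case: eqP => [e|]; last by rewrite mulr0 scale0r.
by rewrite -(submK le) -e submK ?eqxx in ne.
Qed.

Lemma fine_part_eq0 m z : fine_part m z = 0 <->
  (forall T, (cmpl_mnm T <= m)%MM -> (z T : R)@_(m - cmpl_mnm T) = 0).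
Proof.
split=> [/ffunP z0 T le|z0].
  have := z0 T; rewrite !ffunE le => /(congr1 (fun p : R =>
    p@_(m - cmpl_mnm T))).
  by rewrite mcoeffZ mcoeffX eqxx mulr1 mcoeff0.
by apply/ffunP => T; rewrite !ffunE; case: ifP => // /z0 ->; rewrite scale0r.
Qed.

Lemma of_deg_fine_part d m z : of_deg d z -> of_deg d (fine_part m z).
Proof.
move=> zd T; rewrite ffunE; case: ifP => [_ nz|]; last by rewrite eqxx.
by apply: zd; apply: contraNneq nz => ->; rewrite mcoeff0 scale0r.
Qed.

Lemma of_pred_deg_fine_part d m z : of_pred_deg d z ->
  of_pred_deg d (fine_part m z).
Proof.
move=> zd T; rewrite ffunE; case: ifP => [_ nz|]; last by rewrite eqxx.
by apply: zd; apply: contraNneq nz => ->; rewrite mcoeff0 scale0r.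
Qed.

Variable o : term_order n.

Definition below (m : 'X_{1..n}) (z : K) :=
  forall m', fine_part m' z != 0 -> o m' m.

Lemma exists_top z : z != 0 -> exists2 m, fine_part m z != 0 & below m z.
Proof.
(* The finitely many candidates are the multidegrees of the terms of [z]. *)
move=> nz; pose r := [seq m <- flatten [seq [seq (m + cmpl_mnm T)%MM |
  m <- msupp (z T : R)]
   | T <- enum {set 'I_n}] | fine_part m z != 0].
have rP m : fine_part m z != 0 -> m \in r.
  move=> mz; rewrite mem_filter mz /=; apply/flatten_mapP.
  have [T le nzT] : exists2 T, (cmpl_mnm T <= m)%MM &
    (z T : R)@_(m - cmpl_mnm T) != 0.
    apply: contrapT => none; case/eqP: mz; apply/fine_part_eq0 => T le.
    by apply/eqP/negPn/negP => nzT; apply: none; exists T.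
  exists T; first by rewrite mem_enum.
  by apply/mapP; exists (m - cmpl_mnm T)%MM; rewrite ?mcoeff_msupp ?submK.
have [|m mr mmax] := @exists_term_max n o r.
  apply: contraNneq nz => r0; apply/eqP/ffunP => T; rewrite ffunE;
    apply/mpolyP => m.
  rewrite mcoeff0; apply/eqP/negPn/negP => nzT.
  suff /rP : fine_part (m + cmpl_mnm T)%MM z != 0 by rewrite r0.
  apply/eqP => /fine_part_eq0 /(_ T); rewrite lem_addl addmK => /(_ isT) /eqP.
  exact/negP.
exists m; first by move: mr; rewrite mem_filter => /andP[].
by move=> m' /rP /mmax.
Qed.

Variable J : ideal R.

(** The entry at [T] is the term of [z T] at [m - cmpl_mnm T]. If nonzero, it is the leading one,
    since translation by [cmpl_mnm T] reflects the order. *)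
Lemma fine_part_initial m z : below m z -> (forall T, z T \in J) ->
  forall T, fine_part m z T \in initial_ideal o J.
Proof.
move=> zm zJ T; rewrite ffunE; case: ifP => [le|_]; last exact: rpred0.
have [->|nz] := eqVneq (z T : R)@_(m - cmpl_mnm T) 0.
  by rewrite scale0r; apply: rpred0.
rewrite -mul_mpolyC; apply: (@rpredZ _ R^o); apply: mem_submod_span.
exists (z T), (m - cmpl_mnm T)%MM; split=> //.
split=> [|m' m'z]; first by rewrite mcoeff_msupp.
apply: (@term_le_addI n o (cmpl_mnm T)); rewrite submK //; apply: zm.
apply/eqP => /fine_part_eq0 /(_ T); rewrite lem_addl addmK => /(_ isT) /eqP.
by rewrite mcoeff_eq0 m'z.
Qed.

Lemma kdiff_mod (z : K) : (forall T, z T \in J) -> forall T, D z T \in J.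
Proof.
move=> zJ T; rewrite kdiffE; apply: (big_ind (fun y => y \in J)) => [|a b|j _].
- exact: rpred0.
- exact: rpredD.
- exact/rpredZ/zJ.
Qed.

(** The part of [z] at [m] is a cocycle modulo the initial ideal, hence [D w0 + y] with [y] in that
    ideal. Cutting [w0] down to multidegree [m] and lifting the terms of [y] at [m] to elements of
    [J] removes that part of [z]. *)
Lemma koszul_reduce d m z :
    koszul_exact_mod (fun i => 'X_i) (initial_ideal o J) d ->
    of_deg d z -> (forall T, D z T \in J) -> below m z ->
  exists w g : K, [/\ of_pred_deg d w, of_deg d g, forall T, g T \in J &
    forall m', fine_part m' (z - D w - g) != 0 -> term_lt o m' m].
Proof.
move=> ex zd Dz zm.
have [|T|w0 w0d w0P] := ex (fine_part m z); first exact: of_deg_fine_part.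
  rewrite kdiff_fine_part; apply: fine_part_initial => // m' nz; apply: zm.
  by apply: contraNneq nz => z0; rewrite -kdiff_fine_part z0 raddf0.
have [y yE] : exists y : K, y = fine_part m z - D w0 by eexists.
rewrite -yE in w0P.
have yd : of_deg d y.
  by rewrite yE; apply: of_degB; [exact: of_deg_fine_part |
    exact: of_deg_kdiff_pred].
have /choice [g0 g0P] T := initial_ideal_lift (m - cmpl_mnm T)%MM (w0P T).
pose g : K := [ffun T : {set 'I_n} => if (cmpl_mnm T <= m)%MM
  then (g0 T : R^o) else 0].
exists (fine_part m w0), g; split.
- exact: of_pred_deg_fine_part.
- move=> T; rewrite ffunE; case: ifP => [_ nz|]; last by rewrite eqxx.
  apply: yd; apply: contraNneq nz => yT; have [_ + _] := g0P T.
  by rewrite yT mcoeff0 => ->.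
- by move=> T; rewrite ffunE; case: ifP => _; [case: (g0P T) | exact: rpred0].
move=> m' nz.
(* The first summand is [z] without its part at [m]; in the second, [g] cancels the part at [m] and
   leaves lower terms. *)
have e : z - D (fine_part m w0) - g =
    (z - fine_part m z) + (fine_part m y - g).
  by rewrite yE raddfB /= fine_part_id kdiff_fine_part addrA addrA subrK.
have [ltm|nlt] := boolP (term_lt o m' m); first by [].
case/eqP: nz; rewrite e raddfD /= [X in X + _](_ : _ = 0) ?add0r.
  apply/fine_part_eq0 => T le'; rewrite !ffunE; case: ifP => [le|_]; last first.
    by rewrite subr0 mcoeff0.
  apply/eqP/negPn/negP => nzT; have [_ _ /(_ _ nzT)] := g0P T.
  move=> /andP [lt ne]; case/negP: nlt; rewrite /term_lt.
  have := term_le_add (cmpl_mnm T) lt; rewrite !submK // => ->.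
  by apply: contraNneq ne => ->.
rewrite raddfB /=; have [->|ne] := eqVneq m' m;
  first by rewrite fine_part_id subrr.
rewrite fine_part_orth // subr0; apply/eqP/negPn/negP => /zm le.
by rewrite /term_lt le ne in nlt.
Qed.

Theorem koszul_exact_initial d :
  koszul_exact_mod (fun i => 'X_i) (initial_ideal o J) d ->
  koszul_exact_mod (fun i => 'X_i) J d.
Proof.
move=> ex z zd Dz; have [->|/exists_top [m _ zm]] := eqVneq z 0.
  exists 0 => T; first by rewrite ffunE eqxx.
  by rewrite raddf0 subr0 ffunE rpred0.
elim/(well_founded_ind (@term_lt_wf n o)): m z zd Dz zm => m IH z zd Dz zm.
have [w [g [wd gd gJ lt]]] := koszul_reduce ex zd Dz zm.
set z' := z - D w - g in lt.
(* Either nothing is left, or the top multidegree of [z'] is strictly below [m] and the induction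
   hypothesis applies to [z']. *)
have [z'0|/exists_top [m' /lt m'm z'm']] := eqVneq z' 0.
  exists w => // T; suff -> : z - D w = g by [].
  by apply/eqP; rewrite -subr_eq0 -/z' z'0.
have [||w' w'd w'P] := IH _ m'm z' _ _ z'm'.
- by apply: of_degB => //; apply: of_degB => //; apply: of_deg_kdiff_pred.
- move=> T; rewrite /z' !raddfB /= kdiff_sqr subr0 2!ffunE.
  exact: submodB (Dz T) (kdiff_mod gJ T).
exists (w + w') => [|T]; first exact: of_pred_degD.
have -> : z - D (w + w') = z' - D w' + g.
  by rewrite raddfD opprD addrA [RHS]addrAC subrK.
by rewrite ffunE; apply: rpredD.
Qed.

End Semicontinuity.

(** * The depth bound for initially regular sequences *)

Theorem proposition2p2 (k : fieldType) (n : nat)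
    (I : ideal {mpoly k[n]}) (hI : is_proper I)
    (q : nat) (o : nat -> term_order n) (f : nat -> {mpoly k[n]})
    (hf : initially_regular q o I f) :
  le_depth q (depth (var_ideal k n) (lquot I)).
Proof.
(* Induction on [r], hence downwards in [i], vacuous at [i = q]. Each step crosses one initial ideal
   and one regular element, and gains one degree. *)
have ex r i d : (i + r = q)%N -> (d < r)%N ->
    koszul_exact_mod (fun j => 'X_j) (step_ideal o I f i) d.
  elim: r i d => // r IH i d irq dr; have [|_ fi reg] := hf i.
    by rewrite -irq addnS ltnS leq_addr.
  apply: (koszul_exact_regular fi); first exact: regular_on_lquot.
  move=> e ed; apply: (@koszul_exact_initial _ _ (o i.+1)).
  by apply: (IH i.+1); [rewrite addSnnS | apply: leq_trans ed _].
have exI d : (d < q)%N -> koszul_exact (fun j => 'X_j) (lquot I) d.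
  move=> dq; apply/koszul_exact_lquot/(@koszul_exact_initial _ _ (o 0%N)).
  exact: (ex q 0%N).
rewrite /le_depth /depth; case: pselect => // exExt.
case: ex_minnP => d /asboolP dExt _; rewrite leqNgt; apply/negP => dq.
(* It remains that every variable acts as zero on the quotient by [var_ideal]. *)
apply: koszul_not_Ext exI d dq dExt => j.
elim/quotW => v; rewrite -pi_lquot_is_scalable; apply/lquot_eq0.
rewrite /GRing.scale /= mulrC; apply: (@rpredZ _ {mpoly k[n]}^o).
by apply: mem_submod_span; exists j.
Qed.
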